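(* Let $R$ be a Noetherian commutative ring, let $S$ be a commutative $R$-algebra generated as an $R$-algebra by elements $t_1,\dots,t_n$, and let $\mathfrak{M}$ be a nonzero finitely generated $S$-module. The following statements are equivalent. (1) The pair $(\mathfrak{M},P)$ satisfies Property E for every $P\in\mathrm{Spec}(R)$. (2) The pair $(\mathfrak{M},P)$ satisfies Property E for every $P\in\mathrm{Ass}_R(\mathfrak{M})$. (3) $\mathfrak{M}$ is finitely generated as an $R$-module. Here, for an $S$-module $\mathfrak{L}$ and $P\in\mathrm{Spec}(R)$, the pair $(\mathfrak{L},P)$ is said to satisfy Property E if $\kappa(P)\otimes_R\mathfrak{L}$ is a finite-dimensional $\kappa(P)$-vector space and, for every $1\le i\le n$, the eigenvalues of the induced action of $t_i$ on $\kappa(P)\otimes_R\mathfrak{L}$ are integral over $R/P$.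
   Context: An $R$-algebra $S$ is a ring equipped with a ring homomorphism $\iota:R\to S$ (not assumed injective); every $S$-module is an $R$-module via $\iota$. $\mathrm{Spec}(R)$ is the set of prime ideals of $R$. For $P\in\mathrm{Spec}(R)$, $\kappa(P)$ is the residue field of $R$ at $P$, i.e. the quotient field of $R/P$. Eigenvalues are taken in an algebraic closure of $\kappa(P)$. $\mathrm{Ass}_R(\mathfrak{M})$ is the set of associated primes of $\mathfrak{M}$ as an $R$-module: primes $P$ of $R$ of the form $P=\mathrm{Ann}_R(x)$ for some $x\in\mathfrak{M}$. *)

(* Defs.v *)
(* MathComp, with the classical axioms of mathcomp.classical.boolp. *)
From HB Require Import structures.
From mathcomp Require Import all_boot all_algebra.
From mathcomp Require Import boolp.
From mathcomp Require Import freeg.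

Set Implicit Arguments.
Unset Strict Implicit.
Unset Printing Implicit Defensive.

Import GRing.Theory.
Local Open Scope ring_scope.
Local Open Scope quotient_scope.

Definition finitely_generated (A : pzRingType) (M : lmodType A) : Prop :=
  exists (k : nat) (g : 'I_k -> M),
    forall m : M, exists c : 'I_k -> A, m = \sum_(i < k) c i *: g i.

(* The ideals of R are the submodules of R^o. *)
Definition noetherian (R : comNzRingType) : Prop :=
  forall I : {pred R^o}, submod_closed I ->
    exists (k : nat) (g : 'I_k -> R),
      forall x : R, x \in I <-> exists c : 'I_k -> R, x = \sum_(i < k) c i * g i.

Definition generates_algebra (R S : comNzRingType) (iota : {rmorphism R -> S})
    (n : nat) (t : 'I_n -> S) : Prop :=
  forall A : {pred S}, subring_closed A ->
    (forall r, iota r \in A) -> (forall i, t i \in A) -> forall s, s \in A.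

Section RestrictionOfScalars.
Variables (R S : comNzRingType) (iota : {rmorphism R -> S}).

(* M viewed as an R-module through iota. *)
Definition restrict_scalars of {rmorphism R -> S} := fun M : lmodType S => M : Type.

Variable M : lmodType S.
Local Notation M_R := (restrict_scalars iota M).

HB.instance Definition _ := GRing.Zmodule.copy M_R M.

Definition restrict_scale (r : R) (m : M_R) : M_R := iota r *: (m : M).

Fact restrict_scaleA a b m :
  restrict_scale a (restrict_scale b m) = restrict_scale (a * b) m.
Proof. by rewrite /restrict_scale scalerA rmorphM. Qed.
Fact restrict_scale1 : left_id 1 restrict_scale.
Proof. by move=> m; rewrite /restrict_scale rmorph1 scale1r. Qed.
Fact restrict_scaleDr : right_distributive restrict_scale +%R.
Proof. by move=> r m m'; rewrite /restrict_scale scalerDr. Qed.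
Fact restrict_scaleDl m : {morph restrict_scale^~ m : a b / a + b}.
Proof. by move=> a b; rewrite /restrict_scale rmorphD scalerDl. Qed.

HB.instance Definition _ := GRing.Zmodule_isLmodule.Build R M_R
  restrict_scaleA restrict_scale1 restrict_scaleDr restrict_scaleDl.

Definition action (s : S) (m : M_R) : M_R := s *: (m : M).

Fact action_is_linear s : linear (action s).
Proof.
move=> r m m'; rewrite /action scalerDr; congr (_ + _).
by rewrite [LHS]scalerA mulrC -scalerA.
Qed.
HB.instance Definition _ s :=
  GRing.isLinear.Build R M_R M_R _ (action s) (action_is_linear s).

End RestrictionOfScalars.

Arguments action {R S} iota M s m.

(* The tensor product A (x)_R M, where A is an R-algebra through f: the free
   abelian group on A * M modulo the subgroup generated by the usual relators. *)
Section TensorProduct.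
Variables (R A : comNzRingType) (f : {rmorphism R -> A}).

Section Construction.
Variable M : lmodType R.
Local Notation F := {freeg (A * M)%type / int}.

Variant tensor_relator : F -> Prop :=
  | RelatorDl a a' m :
      tensor_relator (<< (a + a', m) >> - << (a, m) >> - << (a', m) >>)
  | RelatorDr a m m' :
      tensor_relator (<< (a, m + m') >> - << (a, m) >> - << (a, m') >>)
  | RelatorZ a r m :
      tensor_relator (<< (a * f r, m) >> - << (a, r *: m) >>).

Definition tensor_ker : {pred F} := fun x => `[< forall H : {pred F},
  zmod_closed H -> (forall y, tensor_relator y -> y \in H) -> x \in H >].

Fact tensor_ker_zmod_closed : zmod_closed tensor_ker.
Proof.
split=> [|x y]; rewrite !unfold_in.
  by apply/asboolP => H [H0 _] _.
move=> /asboolP xK /asboolP yK; apply/asboolP => H HB Hrel.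
by have [_ HB2] := HB; apply: HB2; [apply: xK|apply: yK].
Qed.
HB.instance Definition _ :=
  GRing.isZmodClosed.Build F tensor_ker tensor_ker_zmod_closed.

Definition tensor : Type := Quotient.quot tensor_ker.
HB.instance Definition _ := GRing.Zmodule.on tensor.
HB.instance Definition _ := Quotient.on tensor.

Definition pure_tensor (a : A) (m : M) : tensor := \pi << (a, m) >>.

Fact pi_tensorB : zmod_morphism (\pi : F -> tensor).
Proof. exact: (raddfB (\pi_(Quotient.quot tensor_ker))). Qed.
HB.instance Definition _ :=
  GRing.isZmodMorphism.Build F tensor (\pi : F -> tensor) pi_tensorB.

Fact pi_tensor_eq (x y : F) :
  (\pi x = \pi y :> tensor) <-> x - y \in tensor_ker.
Proof.
have := @Quotient.idealrBE _ tensor_ker x y; rewrite -/tensor => E.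
by split=> [/eqP|H]; [rewrite E | apply/eqP; rewrite -E].
Qed.

Fact tensor_ker_relator x : tensor_relator x -> x \in tensor_ker.
Proof. by move=> xP; apply/asboolP => H _; apply. Qed.

Fact pure_tensorDl m : {morph pure_tensor^~ m : a b / a + b}.
Proof.
move=> a b; apply/eqP; rewrite addrC -subr_eq -pi_tensorB; apply/eqP.
exact/pi_tensor_eq/tensor_ker_relator/RelatorDl.
Qed.

Fact pure_tensorDr a : {morph pure_tensor a : m n / m + n}.
Proof.
move=> m n; apply/eqP; rewrite addrC -subr_eq -pi_tensorB; apply/eqP.
exact/pi_tensor_eq/tensor_ker_relator/RelatorDr.
Qed.

Fact pure_tensorZ a r m : pure_tensor (a * f r) m = pure_tensor a (r *: m).
Proof. exact/pi_tensor_eq/tensor_ker_relator/RelatorZ. Qed.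

Section Lift.
Variables (V : zmodType) (b : A -> M -> V).

(* Meaningful only for balanced b; see tensor_liftE. *)
Definition tensor_lift (x : tensor) : V :=
  fglift (fun p => b p.1 p.2 : ssrint.zmodule V) (repr x).

Definition balanced : Prop :=
  [/\ forall m, {morph b^~ m : a a' / a + a'},
      forall a, {morph b a : m m' / m + m'}
    & forall a r m, b (a * f r) m = b a (r *: m)].

Hypothesis b_balanced : balanced.

Let lift0 : F -> V := fglift (fun p => b p.1 p.2 : ssrint.zmodule V).
Let lift0B : {morph lift0 : x y / x - y}. Proof.
exact: (@lift_is_additive _ _ (ssrint.zmodule V) (fun p => b p.1 p.2)).
Qed.
Let lift0U p : lift0 << p >> = b p.1 p.2.
Proof. by rewrite /lift0 liftU scale1r. Qed.

Let lift0_ker x : x \in tensor_ker -> lift0 x = 0.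
Proof.
have lift0_closed : zmod_closed (fun x => lift0 x == 0 :> V).
  split=> [|y z]; first by rewrite unfold_in -(subrr (0 : F)) lift0B subrr.
  by rewrite !unfold_in lift0B => /eqP -> /eqP ->; rewrite subrr.
move=> /asboolP /(_ _ lift0_closed) xK; apply/eqP/xK => _ [a a' m|a m m'|a r m];
  have [bDl bDr bZ] := b_balanced; rewrite unfold_in !lift0B !lift0U /=.
- by rewrite bDl addrAC addrK subrr.
- by rewrite bDr addrAC addrK subrr.
- by rewrite bZ subrr.
Qed.

Let lift_pi x : tensor_lift (\pi x) = lift0 x.
Proof.
apply/eqP; rewrite -subr_eq0 -[tensor_lift _]/(lift0 _) -lift0B lift0_ker //.
by apply/pi_tensor_eq; rewrite reprK.
Qed.

Fact tensor_liftB : {morph tensor_lift : x y / x - y}.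
Proof.
move=> x y; rewrite -[x]reprK -[y]reprK -pi_tensorB !lift_pi.
exact: lift0B.
Qed.

Fact tensor_liftE a m : tensor_lift (pure_tensor a m) = b a m.
Proof. by rewrite /pure_tensor lift_pi lift0U. Qed.

End Lift.

Fact tensor_ind (Q : tensor -> Prop) :
  (forall x y, Q x -> Q y -> Q (x - y)) -> (forall a m, Q (pure_tensor a m)) ->
  forall x, Q x.
Proof.
move=> QB Qpure x; rewrite -[x]reprK -[repr x]freeg_sumE raddf_sum.
have Q0 : Q 0 by rewrite -(subrr (pure_tensor 0 0)); apply: QB.
have QN y : Q y -> Q (- y) by move=> Qy; rewrite -sub0r; apply: QB.
have QD y z : Q y -> Q z -> Q (y + z).
  by move=> Qy Qz; rewrite -[z]opprK; apply/QB/QN.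
have QMn y k : Q y -> Q (y *+ k).
  by move=> Qy; elim: k => [|k IHk]; rewrite ?mulr0n // mulrS; apply: QD.
apply: big_ind => // -[a m] _; rewrite -[coeff _ _]intz -freegU_mulz raddfMz.
by case: (coeff _ _) => k; [|apply: QN]; apply/QMn/Qpure.
Qed.

End Construction.

Section Module.
Variable M : lmodType R.
Local Notation T := (tensor M).

Definition mul_pure a (a' : A) (m : M) : T := pure_tensor (a * a') m.

Let mul_pure_balanced a : balanced (mul_pure a).
Proof.
split=> [m a1 a2|a' m1 m2|a' r m]; rewrite /mul_pure.
- by rewrite mulrDr pure_tensorDl.
- by rewrite pure_tensorDr.
- by rewrite mulrA pure_tensorZ.
Qed.

Definition tensor_scale (a : A) : T -> T := tensor_lift (mul_pure a).

Fact tensor_scaleE a a' m :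
  tensor_scale a (pure_tensor a' m) = pure_tensor (a * a') m.
Proof. by rewrite /tensor_scale tensor_liftE. Qed.

Let scaleB a : {morph tensor_scale a : x y / x - y}.
Proof. exact/tensor_liftB/mul_pure_balanced. Qed.

Fact tensor_scaleA a b x :
  tensor_scale a (tensor_scale b x) = tensor_scale (a * b) x.
Proof.
elim/tensor_ind: x => [x y IHx IHy|c m]; first by rewrite !scaleB IHx IHy.
by rewrite !tensor_scaleE mulrA.
Qed.
Fact tensor_scale1 : left_id 1 tensor_scale.
Proof.
elim/tensor_ind=> [x y IHx IHy|c m]; first by rewrite !scaleB IHx IHy.
by rewrite tensor_scaleE mul1r.
Qed.
Fact tensor_scaleDr : right_distributive tensor_scale +%R.
Proof.
move=> a x y; have := scaleB a (x + y) y.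
by rewrite addrK => ->; rewrite subrK.
Qed.
Fact tensor_scaleDl x : {morph tensor_scale^~ x : a b / a + b}.
Proof.
move=> a b; elim/tensor_ind: x => [x y IHx IHy|c m].
  by rewrite !scaleB IHx IHy opprD addrACA.
by rewrite !tensor_scaleE mulrDl pure_tensorDl.
Qed.

HB.instance Definition _ := GRing.Zmodule_isLmodule.Build A T
  tensor_scaleA tensor_scale1 tensor_scaleDr tensor_scaleDl.

Fact scale_pure_tensor a a' m :
  a *: pure_tensor a' m = pure_tensor (a * a') m.
Proof. exact: tensor_scaleE. Qed.

End Module.

Section Map.
Variables (M N : lmodType R) (phi : {linear M -> N}).

Definition pure_map (a : A) (m : M) : tensor N := pure_tensor a (phi m).

Let pure_map_balanced : balanced pure_map.
Proof.
split=> [m a1 a2|a m1 m2|a r m]; rewrite /pure_map.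
- by rewrite pure_tensorDl.
- by rewrite linearD pure_tensorDr.
- by rewrite linearZ pure_tensorZ.
Qed.

Definition tensor_map : tensor M -> tensor N := tensor_lift pure_map.

Fact tensor_mapE a m : tensor_map (pure_tensor a m) = pure_tensor a (phi m).
Proof. by rewrite /tensor_map tensor_liftE. Qed.

Let mapB : {morph tensor_map : x y / x - y}.
Proof. exact/tensor_liftB/pure_map_balanced. Qed.

Fact tensor_map_is_linear : linear tensor_map.
Proof.
move=> a x y.
have mapZ z : tensor_map (a *: z) = a *: tensor_map z.
  elim/tensor_ind: z => [z1 z2 IH1 IH2|c m].
    by rewrite scalerBr !mapB IH1 IH2 scalerBr.
  by rewrite scale_pure_tensor !tensor_mapE scale_pure_tensor.
have := mapB (a *: x + y) y.
by rewrite addrK mapZ => ->; rewrite subrK.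
Qed.
HB.instance Definition _ :=
  GRing.isLinear.Build A (tensor M) (tensor N) _ tensor_map tensor_map_is_linear.

End Map.
End TensorProduct.

Arguments pure_tensor {R A} f {M} a m.
Arguments tensor_map {R A} f {M N} phi.

(* prime_idealr R is Spec R: by the classical axioms, every subset of R is a
   boolean predicate. *)
Section ResidueField.
Variables (R : comNzRingType) (P : prime_idealr R).

Definition prime_quot : Type := {ideal_quot P}.
HB.instance Definition _ := GRing.ComNzRing.on prime_quot.

Definition prime_proj : R -> prime_quot := \pi_(Quotient.quot P).
HB.instance Definition _ := GRing.RMorphism.on prime_proj.

Definition prime_quot_unit : {pred prime_quot} := fun x => `[< exists y, y * x = 1 >].
Definition prime_quot_inv (x : prime_quot) : prime_quot :=
  if pselect (exists y, y * x = 1) is left xU then projT1 (cid xU)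
  else x.

Fact prime_quot_mulVr : {in prime_quot_unit, left_inverse 1 prime_quot_inv *%R}.
Proof.
move=> x /asboolP xU; rewrite /prime_quot_inv; case: pselect => // xU'.
exact: (projT2 (cid xU')).
Qed.
Fact prime_quot_unitP x y : y * x = 1 -> prime_quot_unit x.
Proof. by move=> yx; apply/asboolP; exists y. Qed.
Fact prime_quot_invr_out : {in [predC prime_quot_unit], prime_quot_inv =1 id}.
Proof.
by move=> x /asboolPn xU; rewrite /prime_quot_inv; case: pselect.
Qed.
HB.instance Definition _ := GRing.ComNzRing_hasMulInverse.Build prime_quot
  prime_quot_mulVr prime_quot_unitP prime_quot_invr_out.

Fact prime_quot_integral : GRing.integral_domain_axiom prime_quot.
Proof. exact: Quotient.rquot_IdomainAxiom. Qed.
HB.instance Definition _ :=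
  GRing.ComUnitRing_isIntegral.Build prime_quot prime_quot_integral.

Definition residue_field : fieldType := {fraction prime_quot}.

Definition residue_map : R -> residue_field :=
  @FracField.tofrac prime_quot \o prime_proj.
HB.instance Definition _ := GRing.RMorphism.on residue_map.

End ResidueField.

Arguments residue_map {R} P _.

Record algebraic_closure (K : fieldType) := AlgebraicClosure {
  closure_field :> closedFieldType;
  closure_map : {rmorphism K -> closure_field};
  closure_algebraic : forall z, algebraicOver closure_map z
}.

(* An eigenvalue of phi in Kbar has an eigenvector in Kbar (x)_K V. *)
Definition eigenvalue_in (K : fieldType) (Kbar : algebraic_closure K)
    (V : lmodType K) (phi : {linear V -> V}) (z : Kbar) : Prop :=
  exists2 w : tensor (closure_map Kbar) V,
    w != 0 & tensor_map (closure_map Kbar) phi w = z *: w.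

Definition associated_prime (R : comNzRingType) (M : lmodType R)
    (P : prime_idealr R) : Prop :=
  exists x : M, forall r : R, r \in P <-> r *: x = 0.

Section PropertyE.
Variables (R S : comNzRingType) (iota : {rmorphism R -> S}).
Variables (n : nat) (t : 'I_n -> S).
Variables (L : lmodType S) (P : prime_idealr R).

Definition fiber : lmodType (residue_field P) :=
  tensor (residue_map P) (restrict_scalars iota L).

Definition fiber_action (s : S) : {linear fiber -> fiber} :=
  tensor_map (residue_map P)
    (action iota L s : {linear restrict_scalars iota L -> restrict_scalars iota L}).

(* Over a field, finitely generated means finite-dimensional. Property E does not
   depend on which algebraic closure Kbar of the residue field is chosen. *)
Definition property_E (Kbar : algebraic_closure (residue_field P)) : Prop :=
  finitely_generated fiber /\
  forall (i : 'I_n) (z : Kbar), eigenvalue_in (fiber_action (t i)) z ->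
    integralOver (closure_map Kbar \o @FracField.tofrac (prime_quot P)) z.

End PropertyE.

(* Main.v *)
From HB Require Import structures.
Require Import Defs.
From mathcomp Require Import freeg boolp.
From mathcomp Require Import all_boot all_algebra.

(** Write [M] for the module. It is finitely generated over [R] exactly when
    every [t_i] is annihilated on [M] by a monic polynomial [p] over [R], that
    is [p(t_i) M = 0]. If [M] is finitely generated over [R], the
    Cayley-Hamilton theorem yields [p] (finitely_generated_annihilating).
    Conversely, given such polynomials of degrees [d_i], the monomials in the
    [t_i] with exponents bounded by the [d_i], applied to [S]-generators of
    [M], generate [M] over [R] (finitely_generated_restrict).

    Finite generation over [R] gives Property E at every prime [P]: it survives
    the base change to the residue field, and [p(t_i)] still acts as zero
    there, so that an eigenvalue of [t_i] is a root of [p].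

    For the converse, suppose that Property E holds at the associated primes
    but that no monic [p] satisfies [p(t_i) M = 0] for some [i]. Then some
    [x] in [M] is killed by no [p(t_i)] with [p] monic. As [S] is noetherian
    (Hilbert's basis theorem), [x] can be chosen with a maximal annihilator
    [Q] among all such elements; since the elements [p(t_i)] form a
    multiplicative set, [Q] is prime. Its contraction [P] to [R] is the
    annihilator of [x] in [R], an associated prime of [M].

    By Property E at [P], the roots of the characteristic polynomial of [t_i]
    on the fiber [V] at [P] are integral over [R/P]. The product of monic
    equations for these roots is a monic polynomial over [R/P], divisible by the
    characteristic polynomial; lifted to [R], it is a monic [p] such that
    [p(t_i)] acts as zero on [V] (integral_eigenvalues_annihilator).

    It remains to see that an [s] in [S] acting as zero on [V] lies in [Q]
    (fiber_annihilator_prime); for [s = p(t_i)] this says [p(t_i) x = 0], the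
    contradiction sought. The fiber is the localization of [M/PM] at [P]
    (residue_tensor_eq0 is the part of this fact that matters here), so [d s M]
    is contained in [PM], hence in [QM], for some [d] in [R] outside [P].
    By the determinant trick some power of [d s] is, modulo [Q], an
    annihilator of [M], and thus lies in [Q]; so does [s], because [Q] is
    prime and does not contain [d]. *)

Set Implicit Arguments.
Unset Strict Implicit.
Unset Printing Implicit Defensive.

Import GRing.Theory.
Local Open Scope ring_scope.

(** * Submodules and generators *)

Section Submodules.
Variables (A : comNzRingType) (M : lmodType A).

Definition submodule (N : M -> Prop) : Prop :=
  N 0 /\ forall a x y, N x -> N y -> N (a *: x + y).

(** The submodule generated by [s], as an intersection: a property closed under
    linear combinations passes from the generators to the whole submodule by
    mere application. *)
Definition generated (s : seq M) (x : M) : Prop :=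
  forall N, submodule N -> {in s, forall y, N y} -> N x.

Lemma submoduleD N x y : submodule N -> N x -> N y -> N (x + y).
Proof. by case=> _ NP Nx Ny; rewrite -[x]scale1r; apply: NP. Qed.

Lemma submoduleZ N a x : submodule N -> N x -> N (a *: x).
Proof. by case=> N0 NP Nx; rewrite -[_ *: _]addr0; apply: NP. Qed.

Lemma submoduleN N x : submodule N -> N x -> N (- x).
Proof. by move=> NP Nx; rewrite -scaleN1r; apply: submoduleZ. Qed.

Lemma submoduleB N x y : submodule N -> N x -> N y -> N (x - y).
Proof. by move=> NP Nx Ny; apply: submoduleD => //; apply: submoduleN. Qed.

Lemma submodule_sum N (I : Type) (r : seq I) (Q : pred I) (F : I -> M) :
  submodule N -> (forall i, Q i -> N (F i)) -> N (\sum_(i <- r | Q i) F i).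
Proof.
move=> NP NF; apply: big_ind => //; first exact: NP.1.
by move=> x y; apply: submoduleD.
Qed.

Lemma generated_submodule s : submodule (generated s).
Proof.
split=> [N NP _|a x y sx sy N NP sN]; first exact: NP.1.
by apply: NP.2; [apply: sx | apply: sy].
Qed.

Lemma mem_generated s : {in s, forall x, generated s x}.
Proof. by move=> x sx N _; apply. Qed.

Lemma generatedP s x :
  generated s x -> exists c : 'I_(size s) -> A, x = \sum_i c i *: s`_i.
Proof.
move=> /(_ (fun x => exists c : 'I_(size s) -> A, x = \sum_i c i *: s`_i)).
apply=> [|y ys].
  split=> [|a _ _ [c ->] [d ->]].
    by exists (fun=> 0); rewrite big1 // => i _; rewrite scale0r.
  exists (fun i => a * c i + d i); rewrite scaler_sumr -big_split.
  by apply: eq_bigr => i _; rewrite scalerA scalerDl.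
have ys' := ys; rewrite -index_mem in ys'.
exists (fun i => (i == Ordinal ys')%:R); rewrite (bigD1 (Ordinal ys')) //= eqxx.
rewrite scale1r nth_index // big1 ?addr0 // => i /negPf->; exact: scale0r.
Qed.

Lemma finitely_generatedP :
  finitely_generated M <-> exists s : seq M, forall x, generated s x.
Proof.
split=> [[k [g gP]]|[s sP]].
  exists (codom g) => x N NP gN; have [c ->] := gP x.
  by apply: submodule_sum => // i _; apply: submoduleZ => //; apply: gN; apply: codom_f.
by exists (size s), (fun i => s`_i) => x; apply: generatedP.
Qed.

End Submodules.

(** * Noetherian rings *)

Definition ideal (A : comNzRingType) (I : A -> Prop) : Prop :=
  I 0 /\ forall a x y, I x -> I y -> I (a * x + y).

Lemma noetherianP (A : comNzRingType) :
  noetherian A <-> forall I : A -> Prop, ideal I ->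
    exists2 s : seq A, {in s, forall x, I x} & forall x, I x -> generated (M := A^o) s x.
Proof.
split=> [noethA I idI|noethA I idI].
  have [|k [g gP]] := noethA (fun x => `[< I x >]).
    split=> [|a x y]; rewrite !unfold_in; first exact/asboolP/idI.1.
    by move=> /asboolP Ix /asboolP Iy; apply/asboolP/idI.2.
  exists (codom g) => [_ /codomP[i ->]|x Ix N NP gN].
    apply/asboolP/gP; exists (fun j => (j == i)%:R).
    rewrite (bigD1 i) //= eqxx mul1r big1 ?addr0 // => j /negPf ->.
    exact: mul0r.
  have [|c ->] := (gP x).1; first exact/asboolP.
  apply: (submodule_sum (M := A^o)) => // i _.
  apply: (submoduleZ (M := A^o)) => //; apply: gN; exact: codom_f.
have idI' : ideal (fun x => x \in I).
  by split=> [|a x y]; [exact: idI.1 | exact: idI.2].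
have [s sI Is] := noethA _ idI'.
exists (size s), (fun i => s`_i) => x; split=> [/Is/generatedP //|[c ->]].
apply: (@submodule_sum _ _ _ _ _ _ (fun i => c i * s`_i : A^o) idI') => i _.
by apply: (submoduleZ (M := A^o) _ idI'); apply: sI; apply: mem_nth.
Qed.

Lemma noetherian_image (A B : comNzRingType) (f : {rmorphism A -> B}) :
  (forall b, exists a, f a = b) -> noetherian A -> noetherian B.
Proof.
move=> surj /noetherianP noethA; apply/noetherianP => I idI.
have [|s sI Is] := noethA (fun a => I (f a)).
  split=> [|a x y Ix Iy]; first by rewrite rmorph0; apply: idI.1.
  by rewrite rmorphD rmorphM; apply: idI.2.
exists (map f s) => [_ /mapP[x xs ->]|b]; first exact: sI.
have [a <-] := surj b => /Is ax N NP sN.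
apply: (ax (fun a => N (f a))) => [|x xs]; last exact/sN/map_f.
split=> [|c x y Nx Ny]; first by rewrite rmorph0; apply: NP.1.
by rewrite rmorphD rmorphM; apply: NP.2.
Qed.

(** Without a maximal [I x], a strictly increasing sequence of ideals could be
    chosen; its union is finitely generated, hence equal to one of its terms. *)
Lemma noetherian_max (A : comNzRingType) (T : Type) (D : T -> Prop)
    (I : T -> A -> Prop) :
  noetherian A -> (forall x, ideal (I x)) -> (exists x, D x) ->
  exists2 x, D x &
    forall y, D y -> (forall a, I x a -> I y a) -> forall a, I y a -> I x a.
Proof.
move=> /noetherianP noethA idI [x0 Dx0]; apply: contrapT => noMax.
have step (u : {x | D x}) : exists v : {x | D x},
    (forall a, I (sval u) a -> I (sval v) a) /\
    (exists2 a, I (sval v) a & ~ I (sval u) a).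
  case: u => x Dx /=; apply: contrapT => stuck; apply: noMax.
  exists x => // y Dy Ixy a Iya; apply: contrapT => nIxa; apply: stuck.
  by exists (exist _ y Dy); split=> //; exists a.
have [next nextP] := choice step.
pose u k := iter k next (exist _ x0 Dx0).
have u_mono a : {homo u : j k / (j <= k)%N >-> I (sval j) a -> I (sval k) a}.
  apply: homo_leq => [//|y x z xy yz /xy/yz //|k].
  exact: (nextP (u k)).1.
have [|s sU Us] := noethA (fun a => exists k, I (sval (u k)) a).
  split=> [|c x y [j Ix] [k Iy]]; first by exists 0%N; apply: (idI _).1.
  exists (maxn j k); apply: (idI _).2.
    by apply: u_mono Ix; apply: leq_maxl.
  by apply: u_mono Iy; apply: leq_maxr.
have [N sN] : exists N, {in s, forall a, I (sval (u N)) a}.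
  elim: s sU {Us} => [|a s IHs] sU; first by exists 0%N.
  have [|N NP] := IHs; first by move=> b bs; apply: sU; rewrite inE bs orbT.
  have [|k kP] := sU a; first by rewrite inE eqxx.
  exists (maxn N k) => b; rewrite inE => /predU1P[->|/NP bN].
    by apply: u_mono kP; apply: leq_maxr.
  by apply: u_mono bN; apply: leq_maxl.
have [_ [a Ia nIa]] := nextP (u N); apply: nIa.
exact: (Us a (ex_intro _ N.+1 Ia) _ (idI _) sN).
Qed.

(** Hilbert's basis theorem. The coefficients of degree [d] of the polynomials
    of degree at most [d] in [I] form an ideal [lead I d], increasing with [d]
    and stationary from some [N] on. Lifting generators of [lead I d] for
    [d <= N] to polynomials in [I] produces generators of [I]: the leading
    term of any element of [I] can be cancelled, and the degree decreases. *)
Lemma noetherian_poly (A : comNzRingType) : noetherian A -> noetherian {poly A}.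
Proof.
move=> /noetherianP noethA; apply/noetherianP => I idI.
pose lead J d a := exists p : {poly A}, [/\ J p, (size p <= d.+1)%N & p`_d = a].
have lead_ideal J d : ideal J -> ideal (lead J d).
  move=> idJ; split=> [|c _ _ [p [Jp sp <-]] [q [Jq sq <-]]].
    by exists 0; split; rewrite ?size_poly0 ?coef0 //; apply: idJ.1.
  exists (c%:P * p + q); split; first exact: idJ.2.
    rewrite (leq_trans (size_polyD _ _)) // geq_max sq andbT.
    by rewrite mul_polyC (leq_trans (size_scale_leq _ _)).
  by rewrite coefD coefCM.
have lead_shift J d e a : ideal J -> (d <= e)%N -> lead J d a -> lead J e a.
  move=> idJ de [p [Jp sp <-]]; exists ('X^(e - d) * p); split.
  - exact: (submoduleZ (M := {poly A}^o)).
  - have [->|p0] := eqVneq p 0; first by rewrite mulr0 size_poly0.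
    rewrite mulrC size_mulXn // (leq_trans (leq_add (leqnn _) sp)) //.
    by rewrite addnS subnK.
  - by rewrite coefXnM ltnNge leq_subr /= subKn.
have [|s0 s0P s0gen] := noethA (fun a => exists d, lead I d a).
  split=> [|c a b [d da] [e eb]]; first by exists 0%N; apply: (lead_ideal _ _ _).1.
  exists (maxn d e); apply: (lead_ideal _ _ _).2 => //.
    by apply: lead_shift da => //; apply: leq_maxl.
  by apply: lead_shift eb => //; apply: leq_maxr.
have [N NP] : exists N, {in s0, forall a, lead I N a}.
  elim: s0 s0P {s0gen} => [|a s IHs] sP; first by exists 0%N.
  have [|N NP] := IHs; first by move=> b bs; apply: sP; rewrite inE bs orbT.
  have [|k kP] := sP a; first by rewrite inE eqxx.
  exists (maxn N k) => b; rewrite inE => /predU1P[->|/NP bN].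
    by apply: lead_shift kP => //; apply: leq_maxr.
  by apply: lead_shift bN => //; apply: leq_maxl.
have lead_bounded e a : lead I e a -> lead I (minn e N) a.
  case: (leqP e N) => // _ ea.
  exact: (s0gen a (ex_intro _ e ea) _ (lead_ideal _ _ idI) NP).
have /choice[s sP] d : exists s, {in s, forall a, lead I d a} /\
    (forall a, lead I d a -> generated (M := A^o) s a).
  by have [|s s1 s2] := noethA (lead I d); [apply: lead_ideal | exists s].
have /choice[lift liftP] (da : nat * A) : exists p : {poly A}, lead I da.1 da.2 ->
    [/\ I p, (size p <= da.1.+1)%N & p`_da.1 = da.2].
  by case: (pselect (lead I da.1 da.2)) => [[p]|]; [exists p | exists 0].
exists [seq lift (d, a) | d <- iota 0 N.+1, a <- s d].
  by move=> _ /allpairsPdep[d [a [_ /(sP d).1 /(liftP (d, a))[Ip _ _] ->]]].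
move=> p Ip J idJ liftJ.
(* [J] is an ideal containing the lifted generators; working in the ideal
   [I /\ J] keeps the difference in [I] once a leading term is cancelled. *)
have idIJ : ideal (fun p => I p /\ J p).
  split=> [|c x y [Ix Jx] [Iy Jy]]; first by split; [apply: idI.1|apply: idJ.1].
  by split; [apply: idI.2 | apply: idJ.2].
have [n] := ubnP (size p); elim: n p Ip => // n IHn p Ip.
case def_e: (size p) => [|e] le_en.
  by have/eqP := def_e; rewrite size_poly_eq0 => /eqP ->; apply: idJ.1.
set m := minn e N; have le_me : (m <= e)%N by apply: geq_minl.
have [q [[Iq Jq] sq qe]] : lead (fun p => I p /\ J p) e p`_e.
  apply: (@lead_shift _ m) => //.
  have /(sP m).2 : lead I m p`_e by apply: lead_bounded; exists p; rewrite def_e.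
  apply; first exact: lead_ideal.
  move=> a am; have [Ia sa ca] := liftP (m, a) ((sP m).1 _ am).
  exists (lift (m, a)); split=> //; split=> //; apply/liftJ/allpairs_f_dep => //.
  by rewrite mem_iota ltnS geq_minr.
rewrite -(subrK q p); apply: (submoduleD (M := {poly A}^o)) => //.
apply: IHn; first exact: (submoduleB (M := {poly A}^o)).
rewrite ltnS in le_en; apply: leq_ltn_trans le_en; apply/leq_sizeP => j.
rewrite leq_eqVlt coefB => /predU1P[<-|ej]; first by rewrite qe subrr.
by rewrite !nth_default ?subrr ?def_e // (leq_trans sq).
Qed.

(** An [R]-algebra with [n] generators is an image of an [n]-fold iterated
    polynomial ring over [R]. *)
Lemma noetherian_fg_algebra (R S : comNzRingType) (iota : {rmorphism R -> S})
    (n : nat) (t : 'I_n -> S) :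
  noetherian R -> generates_algebra iota t -> noetherian S.
Proof.
move=> noethR genS.
suff [A [f [noethA fR ft]]] : exists (A : comNzRingType) (f : {rmorphism A -> S}),
    [/\ noetherian A, forall r, exists a, f a = iota r
      & forall i, exists a, f a = t i].
  apply: (noetherian_image (f := f)) noethA => s.
  apply/asboolP; apply: (genS (fun s => `[< exists a, f a = s >])) => [|r|i].
  - split=> [|x y|x y]; rewrite !unfold_in.
      by apply/asboolP; exists 1; rewrite rmorph1.
      move=> /asboolP[a <-] /asboolP[b <-]; apply/asboolP.
      by exists (a - b); rewrite rmorphB.
    move=> /asboolP[a <-] /asboolP[b <-]; apply/asboolP.
    by exists (a * b); rewrite rmorphM.
  - exact/asboolP.
  - exact/asboolP.
elim: n t {genS} => [|n IHn] t; first by exists R, iota; split=> [//|r|[]//]; exists r.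
have [A [f [noethA fR ft]]] := IHn (t \o lift ord0).
pose cft a := mulrC (t ord0) (f a).
exists {poly A}, (horner_morph cft); split=> [|r|i]; first exact: noetherian_poly.
  by have [a fa] := fR r; exists a%:P; rewrite /= horner_morphC.
case: (unliftP ord0 i) => [j ->|->]; last by exists 'X; rewrite /= horner_morphX.
by have [a fa] := ft j; exists a%:P; rewrite /= horner_morphC.
Qed.

(** * The determinant trick *)

(** Multiplying the system [B g = 0] by the adjugate of [B] makes it diagonal. *)
Lemma det_annihilates (S : comNzRingType) (M : lmodType S) k (g : 'I_k -> M)
    (B : 'M[S]_k) :
  (forall i, \sum_j B i j *: g j = 0) -> forall j, \det B *: g j = 0.
Proof.
move=> Bg j; transitivity (\sum_i (\adj B) j i *: \sum_l B i l *: g l); last first.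
  by rewrite big1 // => i _; rewrite Bg scaler0.
under eq_bigr do rewrite scaler_sumr; rewrite exchange_big /=.
transitivity (\sum_l (\adj B *m B) j l *: g l).
  rewrite mul_adj_mx (bigD1 j) //= mxE eqxx mulr1n big1 ?addr0 // => l /negPf lj.
  by rewrite mxE eq_sym lj mulr0n scale0r.
apply: eq_bigr => l _; rewrite mxE scaler_suml.
by apply: eq_bigr => i _; rewrite scalerA.
Qed.

(** * Polynomials in an endomorphism and base change *)

Section PolyAct.
Variables (D R : comNzRingType) (iota : {rmorphism D -> R}).

(** The endomorphism [p(phi)]. The coefficients lie in a ring [D] mapped to
    [R], so that one monic polynomial over [D] can be followed along several
    base changes without its length being altered. *)
Definition poly_act (M : lmodType R) (p : {poly D}) (phi : M -> M) (m : M) : M :=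
  \sum_(i < size p) iota p`_i *: iter i phi m.

Lemma poly_act_eigen (M : lmodType R) (p : {poly D}) (phi : {linear M -> M}) z m :
  phi m = z *: m -> poly_act p phi m = (map_poly iota p).[z] *: m.
Proof.
move=> phim; rewrite (@horner_coef_wide _ (size p)) ?size_poly // scaler_suml.
apply: eq_bigr => i _; rewrite coef_map -scalerA; congr (_ *: _).
elim: (val i) => [|j IHj]; first by rewrite expr0 scale1r.
by rewrite iterS IHj linearZ /= phim scalerA exprSr.
Qed.

Lemma poly_actB (M : lmodType R) (p : {poly D}) (phi : {linear M -> M}) :
  {morph poly_act p phi : x y / x - y}.
Proof.
move=> x y; rewrite -sumrB; apply: eq_bigr => i _; rewrite -scalerBr.
by congr (_ *: _); elim: (val i) => [//|j IHj]; rewrite !iterS IHj linearB.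
Qed.

End PolyAct.

Section BaseChange.
Variables (R A : comNzRingType) (f : {rmorphism R -> A}).

Lemma pure_tensor0r (M : lmodType R) a : pure_tensor f a (0 : M) = 0.
Proof. by apply: (addrI (pure_tensor f a (0 : M))); rewrite -pure_tensorDr !addr0. Qed.

Lemma pure_tensor_sumr (M : lmodType R) a (I : Type) (r : seq I) (F : I -> M) :
  pure_tensor f a (\sum_(i <- r) F i) = \sum_(i <- r) pure_tensor f a (F i).
Proof.
elim: r => [|i r IHr]; rewrite ?big_nil ?pure_tensor0r //.
by rewrite !big_cons pure_tensorDr IHr.
Qed.

Lemma pure_tensor0l (M : lmodType R) (m : M) : pure_tensor f 0 m = 0.
Proof. by apply: (addrI (pure_tensor f 0 m)); rewrite -pure_tensorDl !addr0. Qed.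

Lemma pure_tensor_suml (M : lmodType R) (m : M) (I : Type) (r : seq I) (F : I -> A) :
  pure_tensor f (\sum_(i <- r) F i) m = \sum_(i <- r) pure_tensor f (F i) m.
Proof.
elim: r => [|i r IHr]; rewrite ?big_nil ?pure_tensor0l //.
by rewrite !big_cons pure_tensorDl IHr.
Qed.

Lemma finitely_generated_tensor (M : lmodType R) :
  finitely_generated M -> finitely_generated (tensor f M).
Proof.
case=> k [g gP]; exists k, (fun i => pure_tensor f 1 (g i)).
elim/tensor_ind => [x y [c ->] [d ->]|a m].
  exists (fun i => c i - d i); rewrite -sumrB.
  by apply: eq_bigr => i _; rewrite scalerBl.
have [c ->] := gP m; exists (fun i => a * f (c i)).
rewrite pure_tensor_sumr; apply: eq_bigr => i _.
by rewrite scale_pure_tensor mulr1 pure_tensorZ.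
Qed.

Variables (D : comNzRingType) (iota : {rmorphism D -> R}).

Lemma poly_act_pure (M : lmodType R) (p : {poly D}) (phi : {linear M -> M}) a m :
  poly_act (f \o iota) p (tensor_map f phi) (pure_tensor f a m)
    = pure_tensor f a (poly_act iota p phi m).
Proof.
rewrite /poly_act pure_tensor_sumr; apply: eq_bigr => i _.
have -> : iter i (tensor_map f phi) (pure_tensor f a m)
    = pure_tensor f a (iter i phi m).
  by elim: (val i) => [//|j IHj]; rewrite !iterS IHj tensor_mapE.
by rewrite scale_pure_tensor -pure_tensorZ mulrC.
Qed.

Lemma poly_act_tensor0 (M : lmodType R) (p : {poly D}) (phi : {linear M -> M}) :
  (forall m, poly_act iota p phi m = 0) ->
  forall x, poly_act (f \o iota) p (tensor_map f phi) x = 0.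
Proof.
move=> p0; elim/tensor_ind => [x y px py|a m]; first by rewrite poly_actB px py subrr.
by rewrite poly_act_pure p0 pure_tensor0r.
Qed.

End BaseChange.

(** * Eigenvalues on finite-dimensional spaces *)

Section FiniteDimension.
Variables (K : fieldType) (V : lmodType K).

(** A surjection from a space of row vectors of minimal dimension is injective:
    a nontrivial relation between the images of the basis vectors would make
    one of them superfluous. *)
Lemma finite_dimensional_coords : finitely_generated V ->
  exists k (F : {linear 'rV[K]_k -> V}) (xi : {linear V -> 'rV[K]_k}),
    cancel F xi /\ cancel xi F.
Proof.
pose comb k (g : 'I_k -> V) (u : 'rV[K]_k) := \sum_i u 0 i *: g i.
pose gens k := `[< exists g, forall v, exists u, comb k g u = v >].
case=> k0 [g0 g0P].
have gens0 : exists k, gens k.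
  exists k0; apply/asboolP; exists g0 => v; have [c ->] := g0P v.
  by exists (\row_i c i); apply: eq_bigr => i _; rewrite mxE.
have [k /asboolP[g gP] k_min] := ex_minnP gens0.
have comb_linear : linear (comb k g).
  move=> a u v; rewrite scaler_sumr -big_split; apply: eq_bigr => i _.
  by rewrite !mxE scalerDl scalerA.
pose F : {linear 'rV[K]_k -> V} :=
  HB.pack (comb k g) (GRing.isLinear.Build K _ V _ (comb k g) comb_linear).
have F_inj : injective F.
  apply: raddf_inj => u Fu0; apply/rowP => j; rewrite mxE; apply/eqP/negPn/negP => uj.
  case: k => [|k] in g gP k_min comb_linear F u Fu0 j uj *; first by case: j uj.
  suff /k_min : gens k by rewrite ltnn.
  apply/asboolP; exists (g \o lift j) => v; have [c <-] := gP v.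
  (* Subtract from [c] the multiple of the relation [u] which makes the
     coefficient of [g j] vanish. *)
  exists (\row_i (c 0 (lift j i) - c 0 j / u 0 j * u 0 (lift j i))).
  transitivity (comb k.+1 g c - (c 0 j / u 0 j) *: comb k.+1 g u); last first.
    by rewrite [comb _ _ u]Fu0 scaler0 subr0.
  rewrite /comb (bigD1_ord j) //= [X in _ - _ *: X](bigD1_ord j) //=.
  rewrite scalerDr scalerA divfK // opprD addrACA subrr add0r scaler_sumr -sumrB.
  by apply: eq_bigr => i _; rewrite mxE scalerBl scalerA.
have [xi xiK] := choice gP; have FK : cancel F xi by move=> u; apply/F_inj/xiK.
pose Xi : {linear V -> 'rV[K]_k} :=
  HB.pack xi (GRing.isLinear.Build K V _ _ xi (can2_linear FK xiK)).
by exists k, F, Xi.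
Qed.

(** The root [z] has an eigenvector [v] among the row vectors over [Kbar]; its
    combination of the basis vectors [e i] is an eigenvector in the tensor
    product. That it does not vanish is seen by applying to it the coordinate
    functions of [V], extended to the tensor product. *)
Lemma char_poly_root_eigenvalue (Kbar : algebraic_closure K) k
    (F : {linear 'rV[K]_k -> V}) (xi : {linear V -> 'rV[K]_k})
    (phi : {linear V -> V}) (z : Kbar) :
  cancel F xi -> cancel xi F ->
  root (map_poly (closure_map Kbar) (char_poly (lin1_mx (xi \o phi \o F)))) z ->
  eigenvalue_in phi z.
Proof.
set h := closure_map Kbar; set B := lin1_mx _ => FK xiK.
rewrite map_char_poly -eigenvalue_root_char => /eigenvalueP[v vB v0].
pose e i := F (delta_mx 0 i).
exists (\sum_i pure_tensor h (v 0 i) (e i)).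
  have [j vj] := rV0Pn v v0.
  pose coord (a : Kbar) (m : V) := a * h (xi m 0 j).
  have coordP : balanced h coord.
    split=> [m a b|a m m'|a r m]; rewrite /coord ?mulrDl //.
      by rewrite linearD mxE rmorphD mulrDr.
    by rewrite linearZ mxE rmorphM mulrA.
  apply: contra_neq vj => w0.
  have lift0 : tensor_lift coord (0 : tensor h V) = 0.
    by rewrite -(subrr (0 : tensor h V)) (tensor_liftB coordP) subrr.
  suff : tensor_lift coord (\sum_i pure_tensor h (v 0 i) (e i)) = v 0 j.
    by rewrite w0 lift0.
  have liftD (x y : tensor h V) :
      tensor_lift coord (x + y) = tensor_lift coord x + tensor_lift coord y.
    by have := tensor_liftB coordP (x + y) y; rewrite addrK => ->; rewrite subrK.
  rewrite (big_morph _ liftD lift0) (bigD1 j) //= big1 => [|i /negPf ij].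
    by rewrite tensor_liftE // /coord FK mxE !eqxx rmorph1 mulr1 addr0.
  by rewrite tensor_liftE // /coord FK mxE eq_sym ij andbF rmorph0 mulr0.
have phi_e i : phi (e i) = \sum_j B i j *: e j.
  transitivity (F (row i B)).
    by rewrite rowE mul_rV_lin1 /= xiK.
  rewrite [row i B]row_sum_delta linear_sum; apply: eq_bigr => j _.
  by rewrite linearZ mxE.
transitivity (\sum_j pure_tensor h (\sum_i v 0 i * h (B i j)) (e j)).
  rewrite linear_sum /=; under eq_bigr do rewrite tensor_mapE phi_e pure_tensor_sumr.
  rewrite exchange_big; apply: eq_bigr => j _; rewrite pure_tensor_suml.
  by apply: eq_bigr => i _; rewrite pure_tensorZ.
rewrite scaler_sumr; apply: eq_bigr => j _; rewrite scale_pure_tensor.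
congr (pure_tensor h _ (e j)).
have := congr1 (fun u : 'rV_k => u 0 j) vB; rewrite !mxE => <-.
by apply: eq_bigr => i _; rewrite [in RHS]mxE.
Qed.

(** Each root of the characteristic polynomial satisfies a monic equation over
    [D]. The product of these equations is divisible by the characteristic
    polynomial over [Kbar], hence over [K], and the Cayley-Hamilton theorem
    applies. The coefficients of the characteristic polynomial itself are only
    integral over [D], and need not come from [D]. *)
Lemma integral_eigenvalues_annihilator (D : comNzRingType) (iota : {rmorphism D -> K})
    (Kbar : algebraic_closure K) (phi : {linear V -> V}) :
  finitely_generated V ->
  (forall z : Kbar, eigenvalue_in phi z -> integralOver (closure_map Kbar \o iota) z) ->
  exists2 p : {poly D}, p \is monic & forall v, poly_act iota p phi v = 0.
Proof.
set h := closure_map Kbar.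
move=> /finite_dimensional_coords[k [F [xi [FK xiK]]]] int_eigen.
(* Square matrices carry a ring structure only in positive dimension. *)
case: k => [|k] in F xi FK xiK *.
  exists 1; first exact: monic1.
  by move=> v; rewrite -[LHS]xiK [xi _](thinmx0) linear0.
pose B := lin1_mx (xi \o phi \o F).
have [r chiE] := closed_field_poly_normal (map_poly h (char_poly B)).
have lead1 : lead_coef (map_poly h (char_poly B)) = 1.
  by rewrite lead_coef_map (monicP (char_poly_monic B)) rmorph1.
rewrite lead1 scale1r in chiE.
have int_r : {in r, forall z, integralOver (h \o iota) z}.
  move=> z zr; apply/int_eigen/(char_poly_root_eigenvalue FK xiK).
  by rewrite -/h -/B chiE root_prod_XsubC.
have [p p_monic p_dvd] : exists2 p : {poly D}, p \is monic &
    \prod_(z <- r) ('X - z%:P) %| map_poly (h \o iota) p.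
  elim: r int_r {chiE} => [|z r IHr] int_r.
    by exists 1; rewrite ?monic1 // big_nil dvd1p.
  have [|p p_mon p_dvd] := IHr; first by move=> y yr; apply: int_r; rewrite inE yr orbT.
  have [|q q_mon qz] := int_r z; first by rewrite inE eqxx.
  exists (q * p); first by rewrite monicMl.
  by rewrite big_cons rmorphM /= dvdp_mul // dvdp_XsubCl.
exists p => // v.
have Bp : horner_mx B (map_poly iota p) = 0.
  have /dvdpP[q ->] : char_poly B %| map_poly iota p.
    by rewrite -(dvdp_map h) chiE -map_poly_comp.
  by rewrite rmorphM /= Cayley_Hamilton mulr0.
rewrite -[LHS]xiK -[RHS](linear0 F); congr (F _).
have xi_iter i : xi (iter i phi v) = xi v *m B ^+ i.
  elim: i => [|i IHi]; first by rewrite expr0 mulmx1.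
  by rewrite iterS exprSr mulmxA -IHi mul_rV_lin1 /= xiK.
transitivity (xi v *m horner_mx B (map_poly iota p)); last by rewrite Bp mulmx0.
rewrite [map_poly iota p]poly_def rmorph_sum mulmx_sumr linear_sum.
apply: eq_bigr => i _.
by rewrite linearZ /= horner_mxZ -scalemxAr rmorphXn /= horner_mx_X xi_iter.
Qed.

End FiniteDimension.

(** * Residue fields *)

Section Residue.
Variables (R : comNzRingType) (P : prime_idealr R).

Lemma prime_proj_surj (x : prime_quot P) : exists r, prime_proj P r = x.
Proof. by exists (repr x); rewrite /prime_proj reprK. Qed.

Lemma prime_proj_eq0 r : (prime_proj P r == 0) = (r \in P).
Proof.
by rewrite -[r in RHS]subr0 Quotient.idealrBE -[0 in LHS](rmorph0 (prime_proj P)).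
Qed.

Lemma residue_map_eq0 r : (residue_map P r == 0) = (r \in P).
Proof. by rewrite [LHS]tofrac_eq0 prime_proj_eq0. Qed.

Lemma residue_mapB : {morph residue_map P : r s / r - s}.
Proof. exact: rmorphB. Qed.

Lemma residue_mapD : {morph residue_map P : r s / r + s}.
Proof. exact: rmorphD. Qed.

Lemma residue_mapM : {morph residue_map P : r s / r * s}.
Proof. exact: rmorphM. Qed.

Lemma residue_map_eq r s : residue_map P r = residue_map P s -> r - s \in P.
Proof. by move=> rs; rewrite -residue_map_eq0 residue_mapB rs subrr. Qed.

Lemma fractionP (D : idomainType) (x : {fraction D}) :
  exists n d, d != 0 /\ FracField.tofrac d * x = FracField.tofrac n.
Proof.
elim/quotW: x => x; exists (frac x).1, (frac x).2; split; first exact: denom_ratioP.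
unlock FracField.tofrac; rewrite -[LHS]FracField.pi_mul; apply/eqmodP => /=.
rewrite FracField.equivfE /FracField.mulf.
by rewrite !numden_Ratio ?(mul1r, mulr1, oner_neq0, denom_ratioP) // mulrC.
Qed.

Lemma residue_fieldP (a : residue_field P) :
  exists c r, c \notin P /\ residue_map P c * a = residue_map P r.
Proof.
have [n [d [d0 da]]] := fractionP a.
have [[c dc] [r nr]] := (prime_proj_surj d, prime_proj_surj n).
exists c, r; rewrite -prime_proj_eq0 dc; split=> //.
by rewrite /residue_map /= dc nr.
Qed.

Lemma prime_notinM c d : c \notin P -> d \notin P -> c * d \notin P.
Proof. by rewrite prime_idealrM negb_or => -> ->. Qed.

(** An element of [M] which vanishes in the fiber at [P] is moved into [J] by a
    scalar outside [P], for any submodule [J] containing [PM]. Clearing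
    denominators by a scalar [c] turns a formal sum of pure tensors into an
    element of [M], which is well defined modulo [J] as soon as [c] is
    divisible enough. The formal sums whose images lie in [J] for all
    sufficiently divisible [c] form a group containing the relators that
    define the tensor product, hence all formal sums that vanish in it. *)
Lemma residue_tensor_eq0 (M : lmodType R) (J : M -> Prop) (m : M) :
  submodule J -> (forall p x, p \in P -> J (p *: x)) ->
  pure_tensor (residue_map P) 1 m = 0 -> exists2 c, c \notin P & J (c *: m).
Proof.
move=> subJ PMJ.
have Jeq a b x : residue_map P a = residue_map P b -> J (a *: x) -> J (b *: x).
  move=> ab Ja; rewrite -[b](subrK a) scalerDl; apply: submoduleD => //.
  exact/PMJ/residue_map_eq.
(* [num (c, a)] is a numerator of [a] over the denominator [c], if there is
   one. *)
have /choice[num numP] (u : R * residue_field P) : exists r,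
    forall s, residue_map P u.1 * u.2 = residue_map P s ->
              residue_map P u.1 * u.2 = residue_map P r.
  case: (pselect (exists s, residue_map P u.1 * u.2 = residue_map P s)) => [[s us]|no].
    by exists s.
  by exists 0 => s us; case: no; exists s.
pose ev c (x : {freeg (residue_field P * M)%type / int}) : M :=
  fglift (fun q => num (c, q.1) *: q.2 : ssrint.zmodule M) x.
have evB c : {morph ev c : x y / x - y}.
  exact: (@lift_is_additive _ _ (ssrint.zmodule M)).
have evU c q : ev c << q >> = num (c, q.1) *: q.2 by rewrite /ev liftU scale1r.
have clear (a : residue_field P) c s d : residue_map P c * a = residue_map P s ->
    residue_map P (num (d * c, a)) = residue_map P (d * c) * a.
  move=> cas; apply/esym/(numP (d * c, a) (d * s)) => /=.
  by rewrite !residue_mapM -cas mulrA.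
pose H x := `[< exists2 c, c \notin P & forall d, d \notin P -> J (ev (d * c) x) >].
have H_closed : zmod_closed H.
  split=> [|x y]; rewrite !unfold_in.
    apply/asboolP; exists 1 => [|d _].
      by have [] := proper_ideal_subproof (s := P).
    by rewrite -(subrr 0) evB subrr; apply: subJ.1.
  move=> /asboolP[c cP xc] /asboolP[c' c'P yc']; apply/asboolP.
  exists (c * c') => [|d dP]; first exact: prime_notinM.
  rewrite evB; apply: submoduleB => //.
    by rewrite [c * c']mulrC mulrA; apply/xc/prime_notinM.
  by rewrite mulrA; apply/yc'/prime_notinM.
have H_rel x : tensor_relator (residue_map P) x -> x \in H.
  case=> {x} [a a' x|a x x'|a r x]; apply/asboolP.
  - have [[c [s [cP cs]]] [c' [s' [c'P cs']]]] := (residue_fieldP a, residue_fieldP a').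
    exists (c * c') => [|d _]; first exact: prime_notinM.
    rewrite !evB !evU /= -!scalerBl; apply: PMJ.
    rewrite -residue_map_eq0 !residue_mapB.
    rewrite (clear _ _ (c' * s + c * s')); last first.
      by rewrite !(residue_mapM, residue_mapD) -cs -cs' mulrDr; congr (_ + _);
        rewrite -!mulrA // mulrCA.
    rewrite (clear _ _ (c' * s)); last by rewrite !residue_mapM -cs mulrCA mulrA.
    rewrite (clear _ _ (c * s')); last by rewrite !residue_mapM -cs' mulrA.
    by rewrite mulrDr addrAC addrK subrr.
  - exists 1 => [|d _]; first by have [] := proper_ideal_subproof (s := P).
    rewrite !evB !evU /= scalerDr addrAC addrK subrr; exact: subJ.1.
  - have [c [s [cP cs]]] := residue_fieldP a.
    exists c => // d _; rewrite !evB !evU /= scalerA -scalerBl; apply: PMJ.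
    rewrite -residue_map_eq0 residue_mapB residue_mapM (clear a _ s) //.
    by rewrite (clear _ _ (s * r)) ?residue_mapM ?mulrA ?subrr // cs.
move=> m0; have : << (1, m) >> \in tensor_ker (residue_map P) (M := M).
  rewrite -[<< _ >>]subr0; apply/pi_tensor_eq; rewrite raddf0; exact: m0.
move=> /asboolP/(_ H H_closed H_rel)/asboolP[c cP Jc].
exists c => //; have := Jc 1; rewrite mul1r evU /= => Jnum.
apply: Jeq (Jnum _); last by have [] := proper_ideal_subproof (s := P).
by have := @clear 1 c c 1; rewrite !mul1r !mulr1 => ->.
Qed.

End Residue.

Lemma prime_idealr_of (R : comNzRingType) (Q : R -> Prop) :
  ideal Q -> ~ Q 1 -> (forall a b, Q (a * b) -> Q a \/ Q b) ->
  exists P : prime_idealr R, forall r, r \in P <-> Q r.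
Proof.
move=> [Q0 QD] Q1 Qprime; pose I : R -> bool := fun r => `[< Q r >].
have I_ideal : idealr_closed I.
  split=> [||a x y /asboolP Qx /asboolP Qy]; rewrite ?unfold_in.
  - exact/asboolP.
  - exact/asboolP.
  - exact/asboolP/QD.
have I_prime : prime_idealr_closed I.
  move=> a b; rewrite !unfold_in => /asboolP/Qprime[Qa|Qb].
    by apply/orP; left; apply/asboolP.
  by apply/orP; right; apply/asboolP.
pose P : prime_idealr R := HB.pack I (isIdealr.Build R I I_ideal)
  (isPrimeIdealrClosed.Build R I I_prime).
by exists P => r; split=> /asboolP.
Qed.

Lemma surjective_monic_lift (R D : comNzRingType) (f : {rmorphism R -> D})
    (p : {poly D}) :
  (forall y, exists x, f x = y) -> p \is monic ->
  exists2 q : {poly R}, q \is monic & map_poly f q = p.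
Proof.
move=> /choice[g gK] p_monic.
have d0 : (0 < size p)%N by rewrite size_poly_gt0 monic_neq0.
pose d := (size p).-1; pose r := \poly_(i < d) g p`_i.
exists ('X^d + r).
  rewrite monicE lead_coefDl ?lead_coefXn // size_polyXn ltnS.
  exact: size_poly.
apply/polyP => i; rewrite rmorphD /= map_polyXn coefD coefXn coef_map coef_poly.
case: (ltngtP i d) => [lt|gt|->] /=.
- by rewrite add0r gK.
- by rewrite prednK // in gt; rewrite add0r (rmorph0 f) nth_default.
- by rewrite (rmorph0 f) addr0 -[p`_ _]/(lead_coef p) (monicP p_monic).
Qed.

(** A monic equation over [D] lifts to a monic one along a surjection, so that
    integrality over [R/P] can be tested by polynomials over [R]. *)
Lemma integralOver_surj (R D K : comNzRingType) (f : {rmorphism R -> D})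
    (h : {rmorphism D -> K}) (z : K) :
  (forall y, exists x, f x = y) ->
  integralOver (h \o f) z <-> integralOver h z.
Proof.
move=> f_surj; split=> [[p p_monic pz]|[p p_monic pz]].
  by exists (map_poly f p); [apply: monic_map | rewrite -map_poly_comp].
have [q q_monic qp] := surjective_monic_lift f_surj p_monic.
by exists q => //; rewrite map_poly_comp qp.
Qed.

(** * Monic polynomials annihilating a module *)

Section Algebra.
Variables (R S : comNzRingType) (iota : {rmorphism R -> S}) (M : lmodType S).
Local Notation M_R := (restrict_scalars iota M).

Lemma restrict_scalarsE r (m : M_R) : r *: m = (iota r *: (m : M)) :> M.
Proof. by []. Qed.

Lemma poly_act_action (p : {poly R}) s (m : M_R) :
  poly_act idfun p (action iota M s) m = action iota M (map_poly iota p).[s] m.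
Proof.
rewrite /action (@horner_coef_wide _ (size p)) ?size_poly // scaler_suml.
apply: eq_bigr => i _; rewrite coef_map -scalerA; congr (_ *: _).
elim: (val i) => [|j IHj]; first by rewrite expr0 scale1r.
by rewrite iterS IHj exprS -scalerA.
Qed.

(** By residue_tensor_eq0, some [d] outside [P] satisfies [d s M] included in
    [QM]. With respect to the generators [g], [d s] then acts through a matrix
    [q] with entries in [Q], and [\det (d s - q)] annihilates [M], so it lies
    in [Q]. Modulo [Q] this determinant is a power of [d s]. *)
Lemma fiber_annihilator_prime (P : prime_idealr R) (Q : prime_idealr S) (s : S) :
  finitely_generated M ->
  (forall a, (forall m : M, a *: m = 0) -> a \in Q) ->
  (forall r, r \in P <-> iota r \in Q) ->
  (forall m : M_R, pure_tensor (residue_map P) 1 (action iota M s m) = 0) ->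
  s \in Q.
Proof.
move=> [k [g gP]] annQ PQ s0.
pose J (m : M_R) := exists2 c : 'I_k -> S, forall i, c i \in Q & m = \sum_i c i *: g i.
have subJ : submodule J.
  split=> [|a _ _ [c cQ ->] [d dQ ->]].
    exists (fun=> 0) => [i|]; first exact: rpred0.
    by rewrite big1 // => i _; rewrite scale0r.
  exists (fun i => iota a * c i + d i) => [i|].
    by apply: rpredD => //; rewrite prime_idealrM cQ orbT.
  rewrite restrict_scalarsE scaler_sumr -big_split.
  by apply: eq_bigr => i _; rewrite scalerA scalerDl.
have PMJ p (m : M_R) : p \in P -> J (p *: m).
  move=> /PQ pQ; have [c ->] := gP m.
  exists (fun i => iota p * c i) => [i|]; first by rewrite prime_idealrM pQ.
  by rewrite restrict_scalarsE scaler_sumr; apply: eq_bigr => i _; rewrite scalerA.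
have /choice[c cP] i : exists c, c \notin P /\ J (c *: (s *: g i : M_R)).
  by have [c] := residue_tensor_eq0 subJ PMJ (s0 (g i)); exists c.
pose d := \prod_i c i.
have dP : d \notin P.
  rewrite /d; elim/big_ind: _ => [|a b|i _]; last exact: (cP i).1.
    by have [] := proper_ideal_subproof (s := P).
  exact: prime_notinM.
have /choice[q qP] i : exists q : 'I_k -> S,
    (forall j, q j \in Q) /\ iota d * s *: g i = \sum_j q j *: g j.
  have [q qQ dq] : J (d *: (s *: g i : M_R)).
    rewrite /d (bigD1 i) //= mulrC -scalerA.
    by apply: submoduleZ => //; apply: (cP i).2.
  by exists q; split=> //; rewrite -scalerA.
pose B : 'M[S]_k := (iota d * s)%:M - \matrix_(i, j) q i j.
have detB : \det B \in Q.
  apply: annQ => m; have [b ->] := gP m; rewrite scaler_sumr big1 // => j _.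
  rewrite scalerA mulrC -scalerA (det_annihilates (B := B)) ?scaler0 // => i.
  under eq_bigr do rewrite !mxE scalerBl; rewrite sumrB -(qP i).2.
  rewrite (bigD1 i) //= eqxx mulr1n big1 ?addr0 ?subrr // => l /negPf li.
  by rewrite eq_sym li mulr0n scale0r.
have : prime_proj Q (iota d * s) ^+ k == 0.
  move: detB; rewrite -prime_proj_eq0 -(det_map_mx (prime_proj Q)) => /eqP <-.
  rewrite -det_scalar; apply/eqP; congr (\det _).
  apply/matrixP => i j; rewrite !mxE rmorphB rmorphMn /=.
  suff -> : prime_proj Q (q i j) = 0 by rewrite subr0.
  by apply/eqP; rewrite prime_proj_eq0; apply: (qP i).1.
rewrite expf_eq0 prime_proj_eq0 prime_idealrM => /andP[_ /orP[/PQ|//]].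
by rewrite (negPf dP).
Qed.


Definition annihilating (s : S) (p : {poly R}) : Prop :=
  forall m : M, (map_poly iota p).[s] *: m = 0.

(** The Cayley-Hamilton theorem on a module that need not be free: [p] is the
    characteristic polynomial of a matrix describing [s] on generators. *)
Lemma finitely_generated_annihilating (s : S) :
  finitely_generated M_R -> exists2 p, p \is monic & annihilating s p.
Proof.
move=> [k [g gP]].
have /choice[b bP] i : exists b : 'I_k -> R,
    s *: (g i : M) = \sum_j iota (b j) *: (g j : M).
  by have [b] := gP (s *: (g i : M)); exists b.
pose B : 'M[R]_k := \matrix_(i, j) b i j.
exists (char_poly B); first exact: char_poly_monic.
move=> m; have [c ->] := gP m.
rewrite map_char_poly -[_.[s]]/(horner_eval s _) -det_map_mx.
rewrite scaler_sumr big1 // => j _; rewrite restrict_scalarsE scalerA mulrC -scalerA.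
rewrite (det_annihilates (g := g : 'I_k -> M)) ?scaler0 // => i.
under eq_bigr do rewrite !mxE rmorphB rmorphMn /= /horner_eval hornerX hornerC scalerBl.
rewrite sumrB -bP (bigD1 i) //= eqxx mulr1n big1 ?addr0 ?subrr // => l /negPf li.
by rewrite eq_sym li mulr0n scale0r.
Qed.

(** Adjoining the [t i] one at a time, a finite family is built whose [R]-span
    contains the [S]-generators of [M] and is stable under all the [t i]. The
    elements of [S] preserving this span form a subring, hence all of [S]. *)
Lemma finitely_generated_restrict n (t : 'I_n -> S) :
  generates_algebra iota t -> finitely_generated M ->
  (forall i, exists2 p, p \is monic & annihilating (t i) p) ->
  finitely_generated M_R.
Proof.
move=> genS /finitely_generatedP[s0 s0P] ann_t.
suff [s [s0s st]] : exists s : seq M_R, {subset s0 <= s} /\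
    forall i x, generated s x -> generated s (action iota M (t i) x).
  apply/finitely_generatedP; exists s => x.
  suff subS : submodule (fun y : M => generated (M := M_R) s y).
    by apply: (s0P x _ subS) => y /s0s ys; exact: (@mem_generated R M_R s y ys).
  have subs := generated_submodule s.
  pose St := fun a : S =>
    `[< forall x : M_R, generated s x -> generated s (action iota M a x) >].
  have StT a : a \in St.
    apply: (genS St) => [|r|i].
    - split=> [|a1 a2|a1 a2]; rewrite !unfold_in.
      + by apply/asboolP => u; rewrite /action scale1r.
      + move=> /asboolP s1 /asboolP s2; apply/asboolP => u su.
        rewrite /action scalerBl; apply: (submoduleB subs); [exact: s1 | exact: s2].
      + move=> /asboolP s1 /asboolP s2; apply/asboolP => u su.
        by rewrite /action -scalerA; exact: (s1 _ (s2 _ su)).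
    - by apply/asboolP => u; apply: (submoduleZ r subs).
    - by apply/asboolP => u; apply: st.
  split=> [|a y z sy sz]; first exact: subs.1.
  by have /asboolP sa := StT a; apply: (submoduleD subs) (sa y sy) sz.
elim: n t ann_t {genS s0P} => [|n IHn] t ann_t; first by exists s0; split=> [|[]].
have [|s [s0s st]] := IHn (t \o lift ord0); first by move=> i; apply: ann_t.
have [p p_monic pt] := ann_t ord0; set t0 := t ord0 in pt.
(* Since [size p] is one more than the degree, [t0 ^+ 0] occurs even for
   constant [p]. *)
pose s' : seq M_R := [seq t0 ^+ e *: (x : M) | e <- seq.iota 0 (size p), x <- s].
have sub' := generated_submodule s'.
have p_gt0 : (0 < size p)%N by rewrite size_poly_gt0 monic_neq0.
have s'_mem y : y \in s' -> generated s' y.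
  by move=> ys; exact: (@mem_generated R M_R s' y ys).
have s'P e x : (e < size p)%N -> x \in s -> generated s' (action iota M (t0 ^+ e) x).
  by move=> ep xs; apply: (s'_mem); apply: allpairs_f; rewrite ?mem_iota.
exists s'; split=> [x /s0s xs|i].
  by apply/allpairsP; exists (0%N, x); split; rewrite ?mem_iota //= expr0 scale1r.
have act_submodule a : submodule (fun x : M_R => generated s' (action iota M a x)).
  split=> [|r x y sx sy]; first by rewrite (linear0 (action iota M a)); apply: sub'.1.
  by rewrite (linearP (action iota M a)); apply: sub'.2.
have stable a : {in s', forall x, generated s' (action iota M a x)} ->
    forall x, generated s' x -> generated s' (action iota M a x).
  by move=> sa x sx; apply: (sx _ (act_submodule a)).
apply: stable => _ /allpairsP[[e x] /= [ep xs ->]].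
rewrite mem_iota /= add0n in ep.
case: (unliftP ord0 i) => [j ->|->] {i}.
  have -> : action iota M (t (lift ord0 j)) (t0 ^+ e *: (x : M))
      = action iota M (t0 ^+ e) (action iota M (t (lift ord0 j)) x).
    by rewrite /action !scalerA mulrC.
  have sx := st j x (@mem_generated R M_R s x xs).
  by apply: (sx _ (act_submodule _)) => y ys; apply: s'P.
rewrite /action scalerA -exprS -/t0.
have [ltp|lep] := ltnP e.+1 (size p); first exact: s'P.
have def_p : size p = e.+1 by apply/eqP; rewrite eqn_leq lep.
have t0e : t0 ^+ e *: (x : M) = - \sum_(i < e) iota p`_i *: (t0 ^+ i *: (x : M)).
  have := pt x; rewrite (@horner_coef_wide _ (size p)) ?size_poly // def_p.
  rewrite big_ord_recr /= !coef_map /= -[p`_e]/(p`_e.+1.-1) -def_p.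
  rewrite -[p`_(size p).-1]/(lead_coef p) (monicP p_monic) rmorph1 mul1r.
  rewrite scalerDl addrC => /eqP; rewrite addr_eq0 => /eqP ->; congr (- _).
  by rewrite scaler_suml; apply: eq_bigr => i _; rewrite coef_map scalerA.
rewrite exprS -scalerA t0e scalerN scaler_sumr; apply: (submoduleN sub').
apply: (@submodule_sum R M_R _ _ _ _
  (fun i : 'I_e => t0 *: (iota p`_i *: (t0 ^+ i *: (x : M)))) sub') => i _.
rewrite scalerA mulrC -scalerA [t0 *: _]scalerA -exprS.
apply: (submoduleZ _ sub'); apply: s'P => //; exact: leq_ltn_trans (ltn_ord i) ep.
Qed.


End Algebra.

(** * Property E and finite generation *)

Section Equivalence.
Variables (R S : comNzRingType) (iota : {rmorphism R -> S}) (M : lmodType S).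
Local Notation M_R := (restrict_scalars iota M).

Lemma integral_residue (P : prime_idealr R) (Kbar : algebraic_closure (residue_field P))
    (z : Kbar) :
  integralOver (closure_map Kbar \o residue_map P) z <->
  integralOver (closure_map Kbar \o @FracField.tofrac (prime_quot P)) z.
Proof.
exact: (@integralOver_surj R (prime_quot P) Kbar (prime_proj P)
  (closure_map Kbar \o @FracField.tofrac (prime_quot P)) z (@prime_proj_surj R P)).
Qed.

Lemma property_E_finitely_generated n (t : 'I_n -> S) (P : prime_idealr R)
    (Kbar : algebraic_closure (residue_field P)) :
  finitely_generated M_R -> property_E iota t M Kbar.
Proof.
move=> fgM; split=> [|i z [w w0 tw]]; first exact: finitely_generated_tensor.
apply/integral_residue.
have [p p_monic pt] := finitely_generated_annihilating (t i) fgM.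
exists p => //; rewrite rootE; apply: contraNT w0 => pz.
have p0 (m : M_R) : poly_act idfun p (action iota M (t i)) m = 0.
  by rewrite poly_act_action; apply: pt.
have := poly_act_tensor0 (f := closure_map Kbar)
  (poly_act_tensor0 (f := residue_map P) p0) w.
rewrite (poly_act_eigen _ _ tw) => pw0.
by rewrite -[w]scale1r -(mulVf pz) -scalerA pw0 scaler0.
Qed.

Lemma annihilating_fiber (s : S) (P : prime_idealr R)
    (Kbar : algebraic_closure (residue_field P)) :
  finitely_generated (fiber iota M P) ->
  (forall z : Kbar, eigenvalue_in (fiber_action iota M P s) z ->
     integralOver (closure_map Kbar \o @FracField.tofrac (prime_quot P)) z) ->
  exists2 p : {poly R}, p \is monic &
    forall m : M_R,
      pure_tensor (residue_map P) 1 (action iota M (map_poly iota p).[s] m) = 0.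
Proof.
move=> fgV int_eigen.
have [|p p_monic p0] := integral_eigenvalues_annihilator (iota := residue_map P)
    (Kbar := Kbar) (phi := fiber_action iota M P s) fgV.
  by move=> z /int_eigen/integral_residue.
exists p => // m; rewrite -poly_act_action -poly_act_pure; exact: p0.
Qed.

(** An element [x] whose annihilator is maximal among those that contain no
    [p(t i)] with [p] monic has a prime annihilator; the associated prime that
    it defines contradicts Property E. *)
Lemma finitely_generated_of_property_E n (t : 'I_n -> S)
    (kappa_bar : forall P : prime_idealr R, algebraic_closure (residue_field P)) :
  noetherian R -> generates_algebra iota t -> finitely_generated M ->
  (forall P : prime_idealr R, associated_prime M_R P ->
     property_E iota t M (kappa_bar P)) ->
  finitely_generated M_R.
Proof.
move=> noethR genS fgM assE; apply: (finitely_generated_restrict genS fgM) => i.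
set s := t i; pose ev p := (map_poly iota p).[s].
have evM p q : ev (p * q) = ev p * ev q by rewrite /ev rmorphM hornerM.
suff ann1 : forall x : M, exists2 p, p \is monic & ev p *: x = 0.
  have [k [g gP]] := fgM.
  have /choice[p pP] j : exists p, p \is monic /\ ev p *: g j = 0.
    by have [p] := ann1 (g j); exists p.
  exists (\prod_j p j) => [|m]; first by apply: monic_prod => j _; exact: (pP j).1.
  have [c ->] := gP m; rewrite scaler_sumr big1 // => j _.
  rewrite -/(ev _) scalerA mulrC -scalerA (bigD1 j) //= evM.
  by rewrite [ev (p j) * _]mulrC -scalerA (pP j).2 !scaler0.
move=> x0; apply: contrapT => noann.
pose D (x : M) := forall p, p \is monic -> ev p *: x <> 0.
have annI (x : M) : ideal (fun a => a *: x = 0).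
  split=> [|a b c bx cx]; first exact: scale0r.
  by rewrite scalerDl -scalerA bx cx scaler0 addr0.
have [|x Dx x_max] := noetherian_max (D := D) (noetherian_fg_algebra noethR genS) annI.
  by exists x0 => p p_monic px; apply: noann; exists p.
have [|||Q QP] := @prime_idealr_of S (fun a => a *: x = 0).
- exact: annI.
- by rewrite scale1r => x_eq0; apply: (Dx 1 (monic1 _)); rewrite x_eq0 scaler0.
- move=> a b abx; apply: contrapT => /not_orP[ax bx].
  (* If no monic [p] kills [c x], then the annihilator of [c x] cannot be larger
     than that of [x]. *)
  have Dmul c : D (c *: x) -> forall d, d *: (c *: x) = 0 -> d *: x = 0.
    move=> Dcx; apply: (x_max _ Dcx) => d dx.
    by rewrite scalerA mulrC -scalerA dx scaler0.
  have Da : D (a *: x).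
    move=> p p_monic pax; apply: ax; apply: (Dmul (ev p)).
      by move=> q q_monic; rewrite scalerA -evM; apply: Dx; rewrite monicMl.
    by rewrite scalerA mulrC -scalerA.
  by apply: bx; apply: (Dmul a Da); rewrite scalerA mulrC.
have [||| P PP] := @prime_idealr_of R (fun r => iota r *: x = 0).
- have [I0 ID] := annI x; split=> [|a b c bx cx]; first by rewrite rmorph0.
  by rewrite rmorphD rmorphM; apply: ID.
- by rewrite rmorph1 -QP; apply/negP; have [] := proper_ideal_subproof (s := Q).
- by move=> a b; rewrite rmorphM -!QP prime_idealrM => /orP.
have [fgV int_eigen] := assE P (ex_intro _ (x : M_R) PP).
have [p p_monic p0] := annihilating_fiber fgV (int_eigen i).
apply: (Dx p p_monic); apply/QP/(fiber_annihilator_prime fgM _ _ p0).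
  by move=> a a0; apply/QP.
by move=> r; rewrite QP PP.
Qed.

End Equivalence.

Theorem theorem7 (R S : comNzRingType) (iota : {rmorphism R -> S})
    (n : nat) (t : 'I_n -> S) (M : lmodType S)
    (kappa_bar : forall P : prime_idealr R, algebraic_closure (residue_field P)) :
  noetherian R ->
  generates_algebra iota t ->
  (exists m : M, m <> 0) ->
  finitely_generated M ->
  [/\ (forall P : prime_idealr R, property_E iota t M (kappa_bar P))
      <-> (forall P : prime_idealr R,
             associated_prime (restrict_scalars iota M) P ->
             property_E iota t M (kappa_bar P))
    & (forall P : prime_idealr R,
         associated_prime (restrict_scalars iota M) P ->
         property_E iota t M (kappa_bar P))
      <-> finitely_generated (restrict_scalars iota M)].
Proof.
move=> noethR genS _ fgM.
have fg_of_E := finitely_generated_of_property_E (kappa_bar := kappa_bar) noethR genS fgM.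
have E_of_fg P := property_E_finitely_generated t (kappa_bar P).
split; split.
- by move=> allE P _; apply: allE.
- by move=> assE P; apply/E_of_fg/fg_of_E.
- exact: fg_of_E.
- by move=> fgR P _; apply: E_of_fg.
Qed.
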